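(* Let $\alpha>0$, let $\sigma$ be a nonzero finite Borel measure on the unit sphere $S\subset\mathbb{R}^d$, and let $\xi,\xi_1,\xi_2,\ldots$ be i.i.d. $\mathbb{R}^d$-valued random vectors with $\xi\in\mathrm{RV}(\alpha,\sigma)$. Let $r\in(0,1)$, and for each sample size $N$ let $n=[N^r]$ and $m=[N/n]$. Then for every Borel set $B\subset S$ with $\sigma(\partial B)=0$, $$\hat\sigma_N(B)=\frac1n\sum_{i=1}^n \mathbf{1}_B(\theta_{m,i})\longrightarrow\tilde\sigma(B)\quad\text{almost surely as }N\to\infty,$$ where $\tilde\sigma(\cdot)=\sigma(\cdot)/\sigma(S)$.
   Context: $\|\cdot\|$ is the Euclidean norm on $\mathbb{R}^d$, $S=\{x\in\mathbb{R}^d:\|x\|=1\}$, $\partial B$ is the boundary of $B$ in $S$, and $[a]$ is the integer part of $a$. $X\in\mathrm{RV}(\alpha,\sigma)$ means: there is a slowly varying function $\tilde L$ (i.e. $\tilde L(\lambda x)/\tilde L(x)\to1$ as $x\to\infty$ for all $\lambda>0$) such that, with $b_n=n^{1/\alpha}\tilde L(n)$, for all $\rho>0$ and all Borel $B\subset S$ with $\sigma(\partial B)=0$, $$\lim_{n\to\infty}n\,\mathbf{P}\{X/\|X\|\in B,\ \|X\|>\rho b_n\}=\sigma(B)\rho^{-\alpha}.$$ The sample $\xi_1,\ldots,\xi_N$ is divided into $n$ disjoint groups $G_{m,1},\ldots,G_{m,n}$ of $m$ vectors each (e.g. $G_{m,i}=\{\xi_{(i-1)m+1},\ldots,\xi_{im}\}$;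 leftover vectors are discarded). Let $\xi_{m,i}$ be the element of $G_{m,i}$ of largest norm (ties broken by taking the smallest index), and let $\theta_{m,i}=\xi_{m,i}/\|\xi_{m,i}\|\in S$ (a fixed arbitrary point of $S$ if $\xi_{m,i}=0$). *)

(* Defs.v *)
From HB Require Import structures.
From mathcomp Require Import all_boot all_order all_algebra finmap.
From mathcomp Require Import all_classical all_reals all_analysis.

Set Implicit Arguments.
Unset Strict Implicit.
Unset Printing Implicit Defensive.

Import Order.TTheory GRing.Theory Num.Theory.
Import numFieldNormedType.Exports.

Local Open Scope classical_set_scope.
Local Open Scope ring_scope.

(* The norm that the library puts on ['rV[R]_d] is the sup norm. *)
Definition enorm (R : realType) (d : nat) (x : 'rV[R]_d) : R :=
  Num.sqrt (\sum_(i < d) x 0 i ^+ 2).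

(* The dimension is written [d.+1]: measurable types have to be inhabited, and
   the unit sphere of R^0 is empty (it carries no nonzero measure). *)
Definition sphere (R : realType) (d : nat) : set 'rV[R]_d.+1 :=
  [set x | enorm x = 1].
Arguments sphere : clear implicits.

Lemma sphere_delta (R : realType) (d : nat) :
  (delta_mx 0 0 : 'rV[R]_d.+1) \in sphere R d.
Proof.
rewrite inE /sphere /= /enorm (bigD1 ord0) //= big1 => [|i i0].
  by rewrite addr0 mxE !eqxx expr1n sqrtr1.
by rewrite mxE (negbTE i0) andbF expr0n.
Qed.

(* The sphere as a type, with the topology induced by R^d. *)
Definition sphere_type (R : realType) (d : nat) : Type :=
  set_type (sphere R d).

HB.instance Definition _ (R : realType) (d : nat) :=
  SubChoice.on (sphere_type R d).
HB.instance Definition _ (R : realType) (d : nat) :=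
  Topological.on (sphere_type R d).
HB.instance Definition _ (R : realType) (d : nat) :=
  isPointed.Build (sphere_type R d) (SigSub (sphere_delta R d)).

Definition borel_space (R : realType) (d : nat) :=
  g_sigma_algebraType (@open 'rV[R]_d.+1).

Definition borel_sphere (R : realType) (d : nat) :=
  g_sigma_algebraType (@open (sphere_type R d)).

Definition boundary (T : topologicalType) (B : set T) : set T :=
  closure B `\` interior B.

(* [x / ||x||], or [s0] when [x = 0], as then [0^-1 *: 0 = 0] is not on the
   sphere. *)
Definition direction (R : realType) (d : nat) (s0 : sphere_type R d)
    (x : 'rV[R]_d.+1) : sphere_type R d :=
  insubd s0 ((enorm x)^-1 *: x).

Definition slowly_varying (R : realType) (L : R -> R) : Prop :=
  forall lambda : R, 0 < lambda ->
    L (lambda * x) / L x @[x --> +oo] --> (1 : R).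

(* X \in RV(alpha, sigma).  The vectors [x] such that [x / ||x||] is in [B] are
   taken to be nonzero: [\val @` B] is included in the sphere. *)
Definition in_RV (dd : measure_display) (T : measurableType dd) (R : realType)
    (P : probability T R) (d : nat) (X : {RV P >-> borel_space R d})
    (alpha : R) (sigma : {finite_measure set (borel_sphere R d) -> \bar R}) :
    Prop :=
  exists L : R -> R, slowly_varying L /\
    let b (n : nat) : R := n%:R `^ alpha^-1 * L n%:R in
    forall (rho : R) (B : set (borel_sphere R d)),
      0 < rho -> measurable B ->
      sigma (boundary (B : set (sphere_type R d))) = 0%E ->
      (n%:R%:E * P [set t | ((\val : sphere_type R d -> 'rV[R]_d.+1) @` B)
                               ((enorm (X t))^-1 *: (X t : 'rV[R]_d.+1)) /\
                             (rho * b n < enorm (X t))%R])%E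
        @[n --> \oo] --> (sigma B * (rho `^ (- alpha))%:E)%E.

Definition mutually_independent (dd dd' : measure_display)
    (T : measurableType dd) (T' : measurableType dd') (R : realType)
    (P : probability T R) (I : choiceType) (X : I -> {RV P >-> T'}) : Prop :=
  forall (J : {fset I}) (A : I -> set T'),
    (forall i, i \in J -> measurable (A i)) ->
    P (\bigcap_(i in [set` J]) (X i @^-1` A i)) =
    (\prod_(i <- J) P (X i @^-1` A i))%E.

Definition identically_distributed (dd dd' : measure_display)
    (T : measurableType dd) (T' : measurableType dd') (R : realType)
    (P : probability T R) (I : choiceType) (X : I -> {RV P >-> T'}) : Prop :=
  forall (i j : I) (A : set T'), measurable A ->
    P (X i @^-1` A) = P (X j @^-1` A).

Definition iid (dd dd' : measure_display)
    (T : measurableType dd) (T' : measurableType dd') (R : realType)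
    (P : probability T R) (I : choiceType) (X : I -> {RV P >-> T'}) : Prop :=
  mutually_independent X /\ identically_distributed X.

Definition num_groups (R : realType) (r : R) (N : nat) : nat :=
  Num.truncn ((N%:R : R) `^ r).

Definition group_size (R : realType) (r : R) (N : nat) : nat :=
  (N %/ num_groups r N)%N.

(* [G] gives the sets of indices of [n] disjoint groups of [m] vectors each in a
   sample of size [N]. *)
Definition is_grouping (N m n : nat) (G : 'I_n -> {set 'I_N}) : Prop :=
  (forall i, #|G i| = m) /\
  (forall i j k, k \in G i -> k \in G j -> i = j).

(* The vector of largest norm in the group [A] of the sample [x], the one of
   smallest index in case of ties (and 0 if [A] is empty). *)
Definition group_max (R : realType) (d N : nat) (x : 'I_N -> 'rV[R]_d.+1)
    (A : {set 'I_N}) : 'rV[R]_d.+1 :=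
  oapp x 0 [pick k in A | [forall l in A, (enorm (x l) < enorm (x k)) ||
                            ((enorm (x l) == enorm (x k)) && (k <= l)%N)]].

Definition sigma_hat (R : realType) (d N n : nat) (s0 : sphere_type R d)
    (x : 'I_N -> 'rV[R]_d.+1) (G : 'I_n -> {set 'I_N})
    (B : set (sphere_type R d)) : R :=
  n%:R^-1 * \sum_(i < n) \1_B (direction s0 (group_max x (G i))).

(* Main.v *)
(* Only upper bounds are needed: applied to [B] and to its complement, they give
   the limit.  Let [D_0 = set0], [D_1], ..., [D_J] be the tails
   [||x|| > rho_i b_m] with [rho_i^(-alpha) = i h].  The direction of the maximum
   of a group of size [m] can only be in [B] if no vector is in [D_J], or if some
   vector is in [D_(i+1) \ D_i] with direction in [B] while all of them avoid
   [D_i].  These are finitely many rectangles, whose total probability tends to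
   [e^(-sJh) + sum_(i<J) sigma(B) h e^(-sih)] with [s = sigma(S)]; this Riemann sum
   is close to [sigma(B) / s] for small [h] and large [Jh].  Rectangles of
   different groups are independent, so a Chernoff bound for the number of groups
   hitting their rectangles is exponentially small in [n ~ N^r], hence summable in
   [N], and Borel-Cantelli concludes. *)
Require Import Defs.
From HB Require Import structures.
From mathcomp Require Import all_boot all_order all_algebra finmap.
From mathcomp Require Import all_classical all_reals all_analysis.
From mathcomp Require Import measurable_realfun zify ring lra.

Set Implicit Arguments.
Unset Strict Implicit.

Import Order.TTheory GRing.Theory Num.Theory.
Import numFieldNormedType.Exports.

Local Open Scope classical_set_scope.
Local Open Scope ring_scope.

(** * Euclidean norm, cones and measurability of the direction *)

Lemma cvg_sumr (R : realType) (I U : Type) (F : set_system U) {FF : Filter F}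
    (s : seq I) (f : I -> U -> R) (l : I -> R) :
  (forall i, f i x @[x --> F] --> l i) ->
  \sum_(i <- s) f i x @[x --> F] --> \sum_(i <- s) l i.
Proof.
move=> fl; elim: s => [|i s IH].
  by rewrite big_nil; under eq_fun do rewrite big_nil; exact: cvg_cst.
by rewrite big_cons; under eq_fun do rewrite big_cons; exact: cvgD.
Qed.

Lemma enorm_continuous (R : realType) (d : nat) :
  continuous (@enorm R d.+1).
Proof.
rewrite /enorm => x.
apply: (@continuous_comp _ _ _ (fun y : 'rV[R]_d.+1 => \sum_(i < d.+1) y 0 i ^+ 2)
  (@Num.sqrt R)); last exact: sqrt_continuous.
apply: (@cvg_sumr R _ _ (nbhs x)) => i.
apply: (@continuous_comp _ _ _ (fun y : 'rV[R]_d.+1 => y 0 i) (fun u : R => u ^+ 2)).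
  exact: coord_continuous.
exact: exprn_continuous.
Qed.

Lemma enormZ (R : realType) (d : nat) (a : R) (x : 'rV[R]_d) :
  enorm (a *: x) = `|a| * enorm x.
Proof.
rewrite /enorm -sqrtr_sqr -sqrtrM ?sqr_ge0// mulr_sumr.
by congr Num.sqrt; apply: eq_bigr => i _; rewrite mxE exprMn.
Qed.

Lemma normalize_sphere (R : realType) (d : nat) (x : 'rV[R]_d.+1) :
  ((enorm x)^-1 *: x \in sphere R d) = (enorm x != 0).
Proof.
rewrite /sphere; apply/idP/idP; rewrite inE /= enormZ normfV ger0_norm ?sqrtr_ge0 //.
  by apply: contra_eq_neq => ->; rewrite mulr0 eq_sym oner_neq0.
by move=> x0; rewrite mulVf.
Qed.

(** The direction event of [in_RV], written as a set of vectors so that it can be intersected with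
    tails. *)
Definition cone {R : realType} {d : nat} (B : set (sphere_type R d)) :
    set 'rV[R]_d.+1 :=
  [set x | ((\val : sphere_type R d -> 'rV[R]_d.+1) @` B) ((enorm x)^-1 *: x)].

(** At the origin [(enorm x)^-1 *: x] is 0, off the sphere; elsewhere it lies on the sphere, so the
    default [s0] never enters. *)
Lemma coneE (R : realType) (d : nat) (s0 : sphere_type R d)
    (B : set (sphere_type R d)) :
  cone B = [set x | enorm x != 0] `&` direction s0 @^-1` B.
Proof.
rewrite /cone; apply/seteqP; split => x /=; rewrite -normalize_sphere /direction.
  move=> [u Bu ux]; rewrite -ux; split; first exact: valP.
  by rewrite valKd.
by move=> [xS Bx]; exists (insubd s0 ((enorm x)^-1 *: x)); rewrite // insubdK.
Qed.

Lemma measurable_enorm_gt (R : realType) (d : nat) (a : R) :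
  measurable ([set x | a < enorm x] : set (borel_space R d)).
Proof.
apply: sub_sigma_algebra => /=.
exact: (open_comp (fun x _ => @enorm_continuous R d x) (@open_gt R a)).
Qed.

(** Away from the origin normalization is continuous, and open sets of the sphere are traces of open
    sets [U] of the ambient space, so preimages are open. *)
Lemma measurable_direction (R : realType) (d : nat) (s0 : sphere_type R d) :
  measurable_fun [set x : borel_space R d | enorm x != 0]
    (direction s0 : borel_space R d -> borel_sphere R d).
Proof.
apply: (@measurability _ _ (borel_space R d) (borel_sphere R d) _ _
  (@open (sphere_type R d))) => // _ [_ [U oU <-] <-].
apply: sub_sigma_algebra => /=.
have -> : [set x : 'rV[R]_d.+1 | enorm x != 0] `&` direction s0 @^-1`
    (set_val @^-1` U) = [set x | enorm x != 0] `&`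
      (fun x => (enorm x)^-1 *: x) @^-1` U.
  apply/seteqP; split => x /= [x0]; rewrite /direction /set_val /=.
    by rewrite insubdK ?normalize_sphere.
  by rewrite insubdK ?normalize_sphere.
rewrite openE => x /= [x0 Ux].
have cx : {for x, continuous (fun x : 'rV[R]_d.+1 => (enorm x)^-1 *: x)}.
  have ci : {for x, continuous (fun y : 'rV[R]_d.+1 => (enorm y)^-1)}.
    apply: continuousV => //; exact: enorm_continuous.
  exact: (cvgZ ci (@cvg_id _ (nbhs x))).
rewrite /interior; apply: filterI.
  have : enorm y @[y --> x] --> enorm x by exact: enorm_continuous.
  move=> /(_ [set u : R | u != 0]); apply.
  exact: open_nbhs_nbhs.
exact: (cx _ (open_nbhs_nbhs (conj oU Ux))).
Qed.

Lemma measurable_cone (R : realType) (d : nat) (B : set (borel_sphere R d)) :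
  measurable B -> measurable (cone B : set (borel_space R d)).
Proof.
move=> mB; rewrite (coneE (SigSub (sphere_delta R d) : sphere_type R d)).
apply: measurable_direction => //.
have -> : [set x : borel_space R d | enorm x != 0] = [set x | 0 < enorm x].
  by apply/seteqP; split => x /=; rewrite lt0r sqrtr_ge0 andbT.
exact: measurable_enorm_gt.
Qed.

(** * Covering the possible positions of a group maximum *)

Lemma group_maxP (R : realType) (d N : nat) (x : 'I_N -> 'rV[R]_d.+1)
    (A : {set 'I_N}) (k0 : 'I_N) : k0 \in A ->
  exists2 k, k \in A & group_max x A = x k /\
    forall l, l \in A -> enorm (x l) <= enorm (x k).
Proof.
move=> Ak0; rewrite /group_max; case: pickP => [k /andP[Ak /forallP kmax]|none].
  exists k => //; split => // l Al.
  by have := kmax l; rewrite Al /= => /orP[/ltW //|/andP[/eqP -> _]].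
(* The [pick] cannot fail: among the vectors of maximal norm, the one of smallest index satisfies
   its predicate. *)
have [k1 Ak1 k1max] := @arg_maxP _ _ _ k0 (fun k => k \in A) (fun k => enorm (x k)) Ak0.
have Pk1 : (k1 \in A) && (enorm (x k1) == enorm (x k1)) by rewrite Ak1 eqxx.
case: (@arg_minnP _ k1 (fun k => (k \in A) && (enorm (x k) == enorm (x k1)))
  (@nat_of_ord N) Pk1) => k /andP[Ak /eqP xk] kmin.
have := none k; rewrite Ak /= => /negP[]; apply/forallP => l; apply/implyP => Al.
have : enorm (x l) <= enorm (x k1) := k1max _ Al.
rewrite xk le_eqVlt => /orP[xl|->//].
by rewrite xl orbC kmin // Al.
Qed.

(** Unless the maximum avoids [D J], take the least index [i.+1] with the maximum in [D i.+1]; it is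
    not 0 because [D 0] is empty. Membership in [D i] passes to vectors of larger norm, so a maximum
    outside [D i] keeps the whole group outside. *)
Lemma direction_group_max_cover (R : realType) (d N : nat)
    (x : 'I_N -> 'rV[R]_d.+1) (A : {set 'I_N}) (s0 : sphere_type R d)
    (B : set (sphere_type R d)) (D : nat -> set 'rV[R]_d.+1) (J : nat) :
  D 0%N = set0 ->
  (forall i y z, D i y -> enorm y <= enorm z -> D i z) ->
  (forall i y, D i y -> enorm y != 0) ->
  B (direction s0 (group_max x A)) ->
  (forall l, l \in A -> (~` D J) (x l)) \/
  exists (i : 'I_J) (k : 'I_N), [/\ k \in A,
    (cone B `&` (D i.+1 `\` D i)) (x k) &
    forall l, l \in A -> (~` D i) (x l)].
Proof.
move=> D0 Dup Dn0 Bmax.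
have [->|[k0 Ak0]] := set_0Vmem A; first by left => l; rewrite inE.
have [k Ak [maxk xmax]] := group_maxP x Ak0.
have [DJk|nDJk] := pselect (D J (x k)); last first.
  by left => l Al DJl; apply: nDJk; exact: Dup DJl (xmax _ Al).
right.
have exD : exists i, `[< D i (x k) >] by exists J; apply/asboolP.
case: (ex_minnP exD) => -[|i] /asboolP Dik mini; first by move: Dik; rewrite D0.
have iJ : (i < J)%N by apply: mini; apply/asboolP.
have nDik : ~ D i (x k).
  by move=> /asboolP /mini; rewrite ltnn.
exists (Ordinal iJ), k; split => //=.
  split; last by split.
  by rewrite (coneE s0); split; [exact: Dn0 Dik|rewrite /= -maxk].
by move=> l Al Dil; apply: nDik; exact: Dup Dil (xmax _ Al).
Qed.

(** * Product rule for rectangles over disjoint groups *)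

Lemma prod_indic (R : realType) (T : Type) (n : nat) (A : 'I_n -> set T) (t : T) :
  \prod_(i < n) (\1_(A i) t : R) = \1_(\bigcap_i A i) t.
Proof.
have [At|nAt] := pselect ((\bigcap_i A i) t).
  rewrite [RHS]indicE mem_set //= big1 // => i _.
  by rewrite indicE mem_set //; exact: At.
rewrite [RHS]indicE memNset //=.
have [i nAit] : exists i, ~ A i t.
  by apply/existsNP => At; apply: nAt => i _.
by rewrite (bigD1 i) //= indicE memNset // mul0r.
Qed.

Section iid_rectangles.
Context (R : realType) (dd dd' : measure_display) (T : measurableType dd)
  (T' : measurableType dd') (P : probability T R) (xi : nat -> {RV P >-> T'}).
Hypothesis hiid : iid xi.

Definition law (A : set T') : R := fine (P (xi 0%N @^-1` A)).

Lemma measurable_xi k (A : set T') : measurable A -> measurable (xi k @^-1` A).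
Proof. by move=> mA; rewrite -[X in measurable X]setTI; exact: measurable_funP. Qed.

Lemma lawE A : measurable A -> P (xi 0%N @^-1` A) = (law A)%:E.
Proof.
by move=> mA; rewrite /law fineK // fin_num_measure //; exact: measurable_xi.
Qed.

Lemma law_ge0 A : 0 <= law A.
Proof. by rewrite /law fine_ge0. Qed.

Lemma lawT : law setT = 1.
Proof. by rewrite /law preimage_setT probability_setT. Qed.

Lemma law_le A C : measurable A -> measurable C -> A `<=` C -> law A <= law C.
Proof.
move=> mA mC AC; rewrite -lee_fin -!lawE //.
by apply: le_measure; rewrite ?inE; [exact: measurable_xi..|move=> t; exact: AC].
Qed.

Lemma lawD A C : measurable A -> measurable C -> A `<=` C ->
  law (C `\` A) = law C - law A.
Proof.
move=> mA mC AC; apply: EFin_inj; rewrite EFinB -!lawE //; last exact: measurableD.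
have mA' := measurable_xi 0 mA; have mC' := measurable_xi 0 mC.
have -> : xi 0%N @^-1` (C `\` A) = xi 0%N @^-1` C `\` xi 0%N @^-1` A by [].
rewrite measureD // ?setIidr //; first by move=> t; exact: AC.
by rewrite ltey_eq fin_num_measure.
Qed.

Lemma iid_bigcap (N : nat) (A : 'I_N -> set T') :
  (forall k, measurable (A k)) ->
  P (\bigcap_(k : 'I_N) (xi k.+1 @^-1` A k)) = (\prod_(k < N) law (A k))%:E.
Proof.
move=> mA; have [indep eqdist] := hiid.
pose J := [fset (val k).+1 | k in 'I_N]%fset.
(* The sample starts at index 1, whence [j.-1]; indices beyond the sample get the trivial constraint
   [setT]. *)
pose A' j : set T' := oapp A setT (insub j.-1).
have A'E k : A' (val k).+1 = A k by rewrite /A' /= valK.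
have mA' j : measurable (A' j).
  by rewrite /A'; case: insub => [k|] /=; [exact: mA|exact: measurableT].
have := indep J A' (fun j _ => mA' j).
have -> : \bigcap_(i in [set` J]) (xi i @^-1` A' i) =
    \bigcap_(k : 'I_N) (xi k.+1 @^-1` A k).
  apply/seteqP; split => t At.
    move=> k _; rewrite -A'E; apply: At; rewrite /= /J.
    by apply/imfsetP; exists k.
  by move=> _ /= /imfsetP[k _ ->]; rewrite A'E; exact: At.
move=> ->; rewrite big_imfset /=; last by move=> i j _ _ [] /val_inj.
rewrite -prodEFin big_enum /=; apply: eq_bigr => k _.
by rewrite A'E (eqdist _ 0%N) // lawE.
Qed.

Variables (N n : nat) (G : 'I_n -> {set 'I_N}) (L : finType)
  (w : 'I_n -> L -> R) (A : 'I_n -> L -> 'I_N -> set T').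
Hypothesis disjG : forall i j k, k \in G i -> k \in G j -> i = j.
Hypothesis w0 : forall i l, 0 <= w i l.
Hypothesis mA : forall i l k, measurable (A i l k).

Definition group_rect (i : 'I_n) (l : L) : set T :=
  \bigcap_(k in [set` G i]) (xi k.+1 @^-1` A i l k).

Lemma measurable_group_rect i l : measurable (group_rect i l).
Proof.
by apply: fin_bigcap_measurable => [|k _]; [exact: finite_finset|exact: measurable_xi].
Qed.

(** Moving the constraints from groups to single vectors turns the event into one rectangle. By
    disjointness a vector is constrained by at most one group, and vectors in no group contribute
    [law setT = 1]. *)
Lemma indep_group_rect (f : 'I_n -> L) :
  P (\bigcap_i group_rect i (f i)) =
  (\prod_(i < n) \prod_(k in G i) law (A i (f i) k))%:E.
Proof.
pose A' k := \bigcap_(i in [set i | k \in G i]) A i (f i) k.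
have mA' k : measurable (A' k).
  by apply: fin_bigcap_measurable => //; exact: finite_finset.
have -> : \bigcap_i group_rect i (f i) = \bigcap_(k : 'I_N) (xi k.+1 @^-1` A' k).
  apply/seteqP; split => t At.
    by move=> k _ i /= Gik; exact: (At i I k Gik).
  by move=> i _ k /= Gik; exact: (At k I i Gik).
rewrite iid_bigcap //; congr EFin.
rewrite (exchange_big_dep predT) //=; apply: eq_bigr => k _.
have [[i Gik]|nG] := pselect (exists i, k \in G i).
  rewrite (big_pred1 i) => [|j].
    congr law; apply/seteqP; split => y; first by apply.
    by move=> Ay j /= Gjk; rewrite (disjG Gjk Gik).
  by apply/idP/eqP => [Gjk|-> //]; exact: disjG Gjk Gik.
rewrite big_pred0 => [|i]; last by apply/negP => Gik; apply: nG; exists i.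
rewrite -lawT; congr law; apply/seteqP; split => // y _ i /= Gik.
by exfalso; apply: nG; exists i.
Qed.

(** Each factor is the weighted number of rectangles hit by the group, [w i l] being the weight of
    label [l]. *)
Definition group_weight (t : T) : R :=
  \prod_(i < n) \sum_(l : L) w i l * \1_(group_rect i l) t.

Lemma measurable_group_weight : measurable_fun setT group_weight.
Proof.
apply: measurable_prod => i _; apply: measurable_sum => l.
apply: measurable_funM => //; apply: measurable_indic.
exact: measurable_group_rect.
Qed.

Lemma group_weight_ge0 t : 0 <= group_weight t.
Proof. by apply: prodr_ge0 => i _; apply: sumr_ge0 => l _; exact: mulr_ge0. Qed.

(** Distributing the product gives one term per choice [f] of a rectangle in each group; each term
    is integrated by independence, and the sums are factored again. *)
Lemma integral_group_weight :
  (\int[P]_t (group_weight t)%:E)%E =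
  (\prod_(i < n) \sum_(l : L) w i l * \prod_(k in G i) law (A i l k))%:E.
Proof.
have WE t : group_weight t = \sum_(f : {ffun 'I_n -> L})
    (\prod_(i < n) w i (f i)) * \1_(\bigcap_i group_rect i (f i)) t.
  rewrite /group_weight bigA_distr_bigA /=; apply: eq_bigr => f _.
  by rewrite big_split /= prod_indic.
have mr (f : 'I_n -> L) : measurable (\bigcap_i group_rect i (f i)).
  apply: fin_bigcap_measurable => [|i _]; first exact: finite_finset.
  exact: measurable_group_rect.
under eq_integral do rewrite WE -sumEFin.
rewrite ge0_integral_sum //; last 2 first.
- move=> f; apply/measurable_EFinP; apply: measurable_funM; first exact: measurable_cst.
  exact: measurable_indic.
- by move=> f t _; rewrite lee_fin mulr_ge0 // prodr_ge0.
rewrite bigA_distr_bigA /= -sumEFin; apply: eq_bigr => f _.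
under eq_integral do rewrite EFinM.
rewrite ge0_integralZl //; last 2 first.
- by apply/measurable_EFinP; exact: measurable_indic.
- by rewrite lee_fin prodr_ge0.
by rewrite integral_indic // setIT big_split EFinM /= indep_group_rect.
Qed.

End iid_rectangles.

(** * Chernoff bound for the number of groups hitting a rectangle *)

Lemma big_option_sum (V : nmodType) (X : finType) (F : option X -> V) :
  \sum_o F o = F None + \sum_x F (Some x).
Proof.
rewrite (bigD1 None) //=; congr (_ + _).
by rewrite (reindex_omap Some id) => [|[x|]] //=; apply: eq_bigl => x; rewrite eqxx.
Qed.

(* Integrating [prod_i (1 + (e^lam - 1) sum_c 1_(rect_(i, c))] bounds the
   exponential moment of the number of groups hitting one of their rectangles;
   this uses the product rule for rectangles only. *)
Section chernoff.
Context (R : realType) (dd : measure_display) (T : measurableType dd)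
  (P : probability T R) (d : nat) (xi : nat -> {RV P >-> borel_space R d}).
Hypothesis hiid : iid xi.
Variables (N m n : nat) (G : 'I_n -> {set 'I_N}).
Hypothesis hG : is_grouping m G.
Variables (C : set (borel_space R d)) (D : nat -> set (borel_space R d)) (J : nat).
Hypotheses (mC : measurable C) (mD : forall i, measurable (D i)).

(** Union bound for one group of size [m]: the factor [m] counts the positions of the vector in the
    slice, and the other [m.-1] vectors avoid [D i]. *)
Definition slice_sum : R :=
  law xi (~` D J) ^+ m + \sum_(i < J)
    (law xi (C `&` (D i.+1 `\` D i)) * law xi (~` D i) ^+ m.-1) *+ m.

(** [None] stands for the constant 1 of the factor, [Some None] for a group avoiding [D J], and
    [Some (Some (j, k))] for vector [k] falling in slice [j]. *)
Let L : finType := option (option ('I_J * 'I_N)).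

Let A (i : 'I_n) (l : L) (k' : 'I_N) : set (borel_space R d) :=
  match l with
  | None => setT
  | Some None => ~` D J
  | Some (Some (j, k)) => if k' == k then C `&` (D j.+1 `\` D j) else ~` D j
  end.

(** Weight 0 for [k] outside the group lets all groups share one label type. *)
Let w (c : R) (i : 'I_n) (l : L) : R :=
  match l with
  | None => 1
  | Some None => c
  | Some (Some (_, k)) => if k \in G i then c else 0
  end.

Let mA i l k : measurable (A i l k).
Proof.
case: l => [[[j k']|]|] //=; last exact: measurableC.
by case: ifP => _; [apply: measurableI => //; exact: measurableD|exact: measurableC].
Qed.

Let w_ge0 c : 0 <= c -> forall i l, 0 <= w c i l.
Proof. by move=> c0 i [[[j k']|]|] //=; case: ifP. Qed.

Let group_factor c i :
  \sum_(l : L) w c i l * \prod_(k in G i) law xi (A i l k) = 1 + c * slice_sum.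
Proof.
have [card_G _] := hG.
rewrite !big_option_sum /= big1 ?mulr1 => [|k _]; last exact: lawT.
congr (_ + _); rewrite /slice_sum mulrDr prodr_const card_G; congr (_ + _).
pose F j k := w c i (Some (Some (j, k))) *
  \prod_(k' in G i) law xi (A i (Some (Some (j, k))) k').
rewrite (eq_bigr (fun p => F p.1 p.2)); last by case.
rewrite -(pair_bigA _ F) /= mulr_sumr /F /=.
apply: eq_bigr => j _.
rewrite (bigID (mem (G i))) /= [X in _ + X]big1 => [|k /negbTE ->]; last by rewrite mul0r.
rewrite addr0 -mulrnAr -(card_G i) -sumr_const !mulr_sumr; apply: eq_bigr => k Gk.
rewrite Gk; congr (_ * _); rewrite (bigD1 k) //= eqxx; congr (_ * _).
rewrite (eq_bigr (fun=> law xi (~` D j))) => [|k' /andP[_ /negbTE ->] //].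
rewrite prodr_const; congr (_ ^+ _).
by rewrite [in RHS](cardD1 k) Gk /=; apply: eq_card => k'; rewrite !inE andbC.
Qed.

(** The bad set [M], where the weight is at least [e^(lam n a)], is bounded by Markov's inequality.
    It is built from the rectangles, which are measurable, and not from the events [E i], which are
    only covered by them. *)
Lemma group_chernoff (lam q a : R) : 0 < lam -> slice_sum <= q ->
  exists M : set T, [/\ measurable M,
    (P M <= (expR (- (n%:R * (lam * a - (expR lam - 1) * q))))%:E)%E &
    forall (E : 'I_n -> set T) t, ~ M t ->
      (forall i, E i t ->
        (forall l, l \in G i -> (~` D J) (xi l.+1 t)) \/
        exists (j : 'I_J) (k : 'I_N), [/\ k \in G i,
          (C `&` (D j.+1 `\` D j)) (xi k.+1 t) &
          forall l, l \in G i -> (~` D j) (xi l.+1 t)]) ->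
      \sum_(i < n) (\1_(E i) t : R) < n%:R * a].
Proof.
move=> lam0 leq; have [_ disjG] := hG.
pose c := expR lam - 1.
have c0 : 0 < c by rewrite subr_gt0 -expR0 ltr_expR.
have wc := w_ge0 (ltW c0).
pose W := group_weight xi G (w c) A.
have mW : measurable_fun setT W by exact: measurable_group_weight.
have W0 t : 0 <= W t by exact: group_weight_ge0.
pose K := expR (lam * (n%:R * a)).
have K0 : 0 < K by exact: expR_gt0.
have mM : measurable [set t | K <= W t].
  have -> : [set t | K <= W t] = setT `&` W @^-1` `[K, +oo[.
    by apply/seteqP; split => t /=; rewrite in_itv /= andbT // => -[].
  exact: mW.
exists [set t | K <= W t]; split => //.
- have := @le_integral_abse _ _ _ P setT measurableT (EFin \o W) K.
  move=> /(_ (proj2 (measurable_EFinP _ _) mW) K0) /=.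
  under [X in (_ <= X)%E]eq_integral do rewrite ger0_norm //.
  rewrite integral_group_weight // (eq_bigr _ (fun i _ => group_factor c i)).
  rewrite prodr_const card_ord setTI.
  have -> : [set t | (K%:E <= `|(W t)%:E|)%E] = [set t | K <= W t].
    by apply/seteqP; split => t /=; rewrite lee_fin ger0_norm.
  rewrite -(fineK (fin_num_measure P _ mM)) -EFinM !lee_fin => KW.
  have Kinv : expR (- (n%:R * (lam * a - (expR lam - 1) * q))) =
      K^-1 * expR (c * q) ^+ n.
    rewrite -expRN -expRM_natl -expRD; congr expR; rewrite /K /c; ring.
  rewrite Kinv mulrC ler_pdivlMr // mulrC (le_trans KW) // lerXn2r ?nnegrE //.
  + rewrite addr_ge0 // mulr_ge0 ?(ltW c0) // /slice_sum addr_ge0 //.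
      by rewrite exprn_ge0 // law_ge0.
    rewrite sumr_ge0 // => i _.
    by rewrite mulrn_wge0 // mulr_ge0 // ?exprn_ge0 // law_ge0.
  (* Here [1 + c * slice_sum <= 1 + c * q <= e^(c q)]. *)
  + by rewrite (le_trans _ (expR_ge1Dx _)) // lerD2l ler_pM2l.
- move=> E t nM cover; rewrite ltNge; apply/negP => na; apply: nM => /=.
  rewrite /K (@le_trans _ _ (expR (lam * \sum_(i < n) \1_(E i) t))) //.
    by rewrite ler_expR ler_pM2l.
  (* Comparison factor by factor: where [E i] holds, a rectangle is hit and the factor is at least
     [1 + c = e^lam]; otherwise it is at least 1. *)
  rewrite mulr_sumr expR_sum; apply: ler_prod => i _; rewrite expR_ge0 /=.
  have rest0 (l : L) : 0 <= w c i l * \1_(group_rect xi G A i l) t :> R.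
    by rewrite mulr_ge0.
  have rectT : \1_(group_rect xi G A i None) t = 1 :> R.
    by rewrite indicE mem_set // => k.
  rewrite big_option_sum {1}/w rectT mulr1.
  have [Et|nEt] := pselect (E i t); last first.
    by rewrite (indicE _ (E i)) memNset // mulr0 expR0 lerDl sumr_ge0.
  rewrite (indicE _ (E i)) mem_set // mulr1 -lerBlDl -/c.
  suff [l [wl Rl]] : exists l, w c i (Some l) = c /\ group_rect xi G A i (Some l) t.
    by rewrite (bigD1 l) // wl indicE mem_set // mulr1 lerDl sumr_ge0.
  have [nD|[j [k [Gk Ck nD]]]] := cover i Et.
    by exists None.
  exists (Some (j, k)); rewrite /= Gk; split => // k' /= Gk'.
  by case: eqP => [->|_]; [exact: Ck|exact: nD].
Qed.

End chernoff.

(** * A Riemann sum of the exponential, and boundaries *)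

Lemma riemann_sum_expR_le (R : realType) (s h : R) (J : nat) : 0 < s -> 0 < h ->
  h * \sum_(i < J) expR (- (s * (i%:R * h))) <= s^-1 + h.
Proof.
move=> s0 h0; have sh0 : 0 < s * h by exact: mulr_gt0.
(* The sum is geometric with ratio [x <= 1 / (1 + s h)], hence at most
   [1 / (1 - x) <= (1 + s h) / (s h)]. *)
pose x := expR (- (s * h)).
have x1 : x <= (1 + s * h)^-1.
  rewrite /x expRN lef_pV2 ?posrE ?expR_gt0 ?expR_ge1Dx //; lra.
have sum1 : (\sum_(i < J) expR (- (s * (i%:R * h)))) * (1 - x) <= 1.
  have -> : \sum_(i < J) expR (- (s * (i%:R * h))) = \sum_(i < J) x ^+ i.
    by apply: eq_bigr => i _; rewrite -expRM_natl; congr expR; ring.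
  have -> : (\sum_(i < J) x ^+ i) * (1 - x) = 1 - x ^+ J.
    by rewrite -[RHS]opprB subrX1 mulrC -mulNr opprB.
  by rewrite lerBlDr lerDl exprn_ge0 // expR_ge0.
set S := \sum_(i < J) _ in sum1 *.
have S0 : 0 <= S by apply: sumr_ge0 => i _; exact: expR_ge0.
have xlow : s * h / (1 + s * h) <= 1 - x.
  rewrite lerBrDl -lerBrDr (le_trans x1) // le_eqVlt; apply/orP; left.
  by apply/eqP; field; lra.
have S1 : S * (s * h / (1 + s * h)) <= 1.
  by rewrite (le_trans _ sum1) // ler_wpM2l.
rewrite -(ler_pM2r (_ : 0 < s / (1 + s * h))); last by rewrite divr_gt0 //; lra.
have -> : (s^-1 + h) * (s / (1 + s * h)) = 1 by field; apply/andP; split; lra.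
by rewrite (le_trans _ S1) // le_eqVlt; apply/orP; left; apply/eqP; ring.
Qed.

Lemma boundaryT (T : topologicalType) : boundary [set: T] = set0.
Proof. by rewrite /boundary closureT interiorT setDv. Qed.

Lemma boundaryC (T : topologicalType) (B : set T) : boundary (~` B) = boundary B.
Proof.
by rewrite /boundary closure_setC interiorC !setDE setCK setIC.
Qed.

(** * Regular variation and the limit of the one-group bound *)

Section limit.
Context (R : realType) (d : nat) (alpha : R)
  (sigma : {finite_measure set (borel_sphere R d) -> \bar R})
  (dd : measure_display) (T : measurableType dd) (P : probability T R)
  (xi : nat -> {RV P >-> borel_space R d}).
Hypotheses (alpha0 : 0 < alpha) (sigma0 : sigma setT <> 0%E).

Let mass (B : set (borel_sphere R d)) : R := fine (sigma B).

Let sigmaE B : measurable B -> sigma B = (mass B)%:E.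
Proof. by move=> mB; rewrite /mass fineK // fin_num_measure. Qed.

Let mass_gt0 : 0 < mass setT.
Proof.
rewrite /mass fine_gt0 //.
by rewrite -ge0_fin_numE // fin_num_measure // andbT lt0e measure_ge0 andbT; apply/eqP.
Qed.

Let mass_ge0 B : 0 <= mass B.
Proof. exact: fine_ge0. Qed.

Definition norm_gt (a : R) : set (borel_space R d) := [set x | a < enorm x].

Let mcone_gt a (B : set (borel_sphere R d)) : measurable B ->
  measurable (cone B `&` norm_gt a : set (borel_space R d)).
Proof.
by move=> mB; apply: measurableI; [exact: measurable_cone|exact: measurable_enorm_gt].
Qed.

Lemma coneT : cone (setT : set (sphere_type R d)) = [set x | enorm x != 0].
Proof.
by rewrite (coneE (SigSub (sphere_delta R d) : sphere_type R d)) preimage_setT setIT.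
Qed.

Lemma norm_gt_coneT a : 0 <= a -> norm_gt a `<=` cone (setT : set (sphere_type R d)).
Proof. by rewrite coneT => a0 x ax /=; rewrite gt_eqF // (le_lt_trans a0). Qed.

Section tails.
Variable b : nat -> R.
Hypothesis hb : forall (rho : R) (B : set (borel_sphere R d)),
  0 < rho -> measurable B ->
  sigma (boundary (B : set (sphere_type R d))) = 0%E ->
  (n%:R%:E * P [set t | ((\val : sphere_type R d -> 'rV[R]_d.+1) @` B)
                           ((enorm (xi 0%N t))^-1 *: (xi 0%N t : 'rV[R]_d.+1)) /\
                         (rho * b n < enorm (xi 0%N t))%R])%E
    @[n --> \oo] --> (sigma B * (rho `^ (- alpha))%:E)%E.

Let tail_cvg (rho : R) (B : set (borel_sphere R d)) : 0 < rho -> measurable B ->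
  sigma (boundary (B : set (sphere_type R d))) = 0%E ->
  n%:R * law xi (cone B `&` norm_gt (rho * b n)) @[n --> \oo] -->
    mass B * rho `^ (- alpha).
Proof.
move=> rho0 mB bB; have := hb rho0 mB bB; rewrite sigmaE // -EFinM.
move=> /fine_cvgP[_]; apply: cvg_trans; apply: near_eq_cvg; near=> n.
by rewrite /= fineM // (_ : P _ = (law xi (cone B `&` norm_gt (rho * b n)))%:E)
  // -lawE //; exact: mcone_gt.
Unshelve. all: by end_near. Qed.

Let sigma_bdT : sigma (boundary (setT : set (sphere_type R d))) = 0%E.
Proof. by rewrite boundaryT measure0. Qed.

(* If [b n < 0] then [norm_gt (b n)] is everything, so its probability does not
   tend to 0. *)
Let b_ge0 : \forall n \near \oo, 0 <= b n.
Proof.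
pose p n := law xi (cone setT `&` norm_gt (b n)).
pose p0 := law xi (cone (setT : set (sphere_type R d))).
have mcT : measurable (cone setT : set (borel_space R d)) by exact: measurable_cone.
have p_le n : p n <= p0.
  by apply: law_le => //; exact: mcone_gt.
have pcvg : n%:R * p n @[n --> \oo] --> mass setT.
  have := tail_cvg ltr01 measurableT sigma_bdT.
  by rewrite powR1 mulr1; under eq_fun do rewrite mul1r.
have p00 : 0 < p0.
  near \oo => n; rewrite (lt_le_trans _ (p_le n)) //.
  have : 0 < n%:R * p n by near: n; exact: (cvgr_gt _ pcvg _ mass_gt0).
  by rewrite pmulr_rgt0 // ltr0n; near: n; exact: nbhs_infty_gt.
near=> n; rewrite leNgt; apply/negP => bn0.
have pn : p n = p0.
  congr law; apply/seteqP; split => x; first by case.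
  by move=> cx; split => //; rewrite /norm_gt /= (lt_le_trans bn0) // sqrtr_ge0.
have : n%:R * p n < mass setT + 1.
  by near: n; apply: (cvgr_lt _ pcvg); rewrite ltrDl.
rewrite pn -ltr_pdivlMr // ltNge => /negP; apply.
by near: n; exact: nbhs_infty_ger.
Unshelve. all: by end_near. Qed.

(* [level h i ^ (- alpha) = i h]: the mass of the [i]-th tail is linear in [i]. *)
Let level (h : R) (i : nat) : R := (i%:R * h) `^ (- alpha^-1).

(** Index 0 stands for an infinite level. The general formula would give [level h 0 = 0], as 0 to a
    nonzero power is 0, and hence all nonzero vectors when [b n] is finite. *)
Let tail (h : R) (n i : nat) : set (borel_space R d) :=
  if i is 0 then set0 else norm_gt (level h i * b n).

(** Expected number, among [n] vectors, of those in the tail with direction in [B]. *)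
Let F (B : set (borel_sphere R d)) h n i := n%:R * law xi (cone B `&` tail h n i).

Let mtail h n i : measurable (tail h n i).
Proof. by case: i => [|i]; [exact: measurable0|exact: (@measurable_enorm_gt R d)]. Qed.

Let F_cvg (B : set (borel_sphere R d)) h i : 0 < h -> measurable B ->
  sigma (boundary (B : set (sphere_type R d))) = 0%E ->
  F B h n i @[n --> \oo] --> mass B * (i%:R * h).
Proof.
move=> h0 mB bB; case: i => [|i].
  under eq_fun do rewrite /F setI0 /law preimage_set0 measure0 mulr0.
  rewrite mul0r mulr0. exact: cvg_cst.
have ih0 : 0 < i.+1%:R * h by rewrite mulr_gt0.
have lev0 : 0 < level h i.+1 by exact: powR_gt0.
have := tail_cvg lev0 mB bB.
by rewrite /level -powRrM mulrNN mulVf ?gt_eqF // powRr1 // ltW.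
Qed.

Let tail_subset h n i : 0 < h -> 0 <= b n -> tail h n i `<=` tail h n i.+1.
Proof.
move=> h0 bn; case: i => [|i] // x; rewrite /tail /norm_gt /=.
apply: le_lt_trans; rewrite ler_wpM2r // /level !powRN.
rewrite lef_pV2 ?posrE ?powR_gt0 ?mulr_gt0 //.
rewrite ge0_ler_powR ?nnegrE ?invr_ge0 ?(ltW alpha0) ?mulr_ge0 ?(ltW h0) //.
by rewrite ler_wpM2r ?(ltW h0) // ler_nat.
Qed.

Let tail_coneT h n i : 0 <= b n ->
  tail h n i `<=` cone (setT : set (sphere_type R d)).
Proof.
move=> bn; case: i => [|i] //=.
by apply: norm_gt_coneT; rewrite mulr_ge0 // powR_ge0.
Qed.

(** What bounds [slice_sum] after [1 - p <= e^(-p)]. The correction [F setT h n i / n%:R] comes from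
    the exponent [n.-1] in place of [n]. *)
Let upper (B : set (borel_sphere R d)) (h : R) (J n : nat) : R :=
  expR (- F setT h n J) + \sum_(i < J) (F B h n i.+1 - F B h n i) *
    expR (- F setT h n i + F setT h n i / n%:R).

Let slice_sum_le (B : set (borel_sphere R d)) h J n :
  0 < h -> 0 <= b n -> (0 < n)%N -> measurable B ->
  slice_sum xi n (cone B) (tail h n) J <= upper B h J n.
Proof.
move=> h0 bn n0 mB; have mC : measurable (cone B : set (borel_space R d)).
  exact: measurable_cone.
have nR : n%:R != 0 :> R by rewrite pnatr_eq0 -lt0n.
have FE i : F setT h n i = n%:R * law xi (tail h n i).
  by rewrite /F setIC setIidl //; exact: tail_coneT.
have out_le i k : law xi (~` tail h n i) ^+ k <=
    expR (- (k%:R * law xi (tail h n i))).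
  have -> : law xi (~` tail h n i) = 1 - law xi (tail h n i).
    by rewrite -setTD lawD // lawT.
  rewrite -mulrN expRM_natl lerXn2r ?nnegrE ?expR_ge0 //; last exact: expR_ge1Dx.
  by rewrite subr_ge0 -(lawT xi); exact: law_le.
rewrite /slice_sum /upper lerD //; first by rewrite FE.
apply: ler_sum => i _; rewrite -mulrnAl ler_pM //.
- by rewrite mulrn_wge0 // law_ge0.
- by rewrite exprn_ge0 // law_ge0.
- have -> : cone B `&` (tail h n i.+1 `\` tail h n i) =
      (cone B `&` tail h n i.+1) `\` (cone B `&` tail h n i).
    by apply/seteqP; split => x /= [? ?]; tauto.
  rewrite lawD; [|exact: measurableI|exact: measurableI|]; last first.
    by apply: setIS; exact: tail_subset.
  by rewrite /F -mulrBr mulr_natl.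
- rewrite (le_trans (out_le _ _)) // ler_expR FE le_eqVlt; apply/orP; left.
  have -> : n.-1%:R = n%:R - 1 :> R by rewrite -[in RHS](prednK n0) -natr1 addrK.
  by apply/eqP; field.
Qed.

Let upper_cvg (B : set (borel_sphere R d)) h J : 0 < h -> measurable B ->
  sigma (boundary (B : set (sphere_type R d))) = 0%E ->
  upper B h J n @[n --> \oo] --> expR (- (mass setT * (J%:R * h))) +
    \sum_(i < J) (mass B * h) * expR (- (mass setT * (i%:R * h))).
Proof.
move=> h0 mB bB.
have Tcvg i : F setT h n i @[n --> \oo] --> mass setT * (i%:R * h) by exact: F_cvg.
have inv_cvg : (n%:R^-1 : R) @[n --> \oo] --> (0 : R).
  apply/gtr0_cvgV0; last exact: cvgr_idn.
  by near=> n; rewrite ltr0n; near: n; exact: nbhs_infty_gt.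
apply: cvgD.
  apply: (@continuous_cvg _ _ _ \oo); first exact: continuous_expR.
  exact: cvgN.
apply: cvg_sumr => i; apply: cvgM.
  (* Consecutive tails differ in limiting mass by [mass B * h], whatever [i]. *)
  have -> : mass B * h = mass B * (i.+1%:R * h) - mass B * (i%:R * h).
    by rewrite -natr1; ring.
  by apply: cvgB; exact: F_cvg.
apply: (@continuous_cvg _ _ _ \oo); first exact: continuous_expR.
rewrite -[X in _ --> X]addr0 -[X in _ + X](mulr0 (mass setT * (i%:R * h))).
by apply: cvgD; [exact: cvgN|exact: cvgM].
Unshelve. all: by end_near. Qed.

(** Here [n] is the group size. [J] is fixed before [n], while the tails [D] depend on [n] through
    [b n]. *)
Lemma tails_bound (B : set (borel_sphere R d)) (eps : R) : measurable B ->
  sigma (boundary (B : set (sphere_type R d))) = 0%E -> 0 < eps ->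
  exists J, \forall n \near \oo, exists D : nat -> set (borel_space R d),
    [/\ D 0%N = set0,
       forall i x y, D i x -> enorm x <= enorm y -> D i y,
       forall i x, D i x -> enorm x != 0,
       forall i, measurable (D i) &
       slice_sum xi n (cone B) D J <= fine (sigma B) / fine (sigma setT) + eps].
Proof.
move=> mB bB eps0; have := mass_gt0; set s := mass setT => s0.
(* This mesh gives [mass B * h <= eps / 4]; adding 1 keeps the denominator positive when [mass B] is
   0. *)
pose h := eps / 4 / (mass B + 1).
have mB1 : 0 < mass B + 1 by rewrite ltr_wpDl.
have h0 : 0 < h by rewrite /h !divr_gt0 //.
have Bh : mass B * h <= eps / 4.
  rewrite /h mulrCA -[leRHS]mulr1 ler_pM2l ?divr_gt0 // ler_pdivrMr // mul1r.
  by rewrite lerDl.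
(* This [J] gives [s J h >= 4 / eps], and [e^(-y) <= 1 / y] makes the first term of the limit at
   most [eps / 4]. *)
pose J := (Num.truncn (4 / eps / (s * h))).+1.
have Jlarge : expR (- (s * (J%:R * h))) <= eps / 4.
  have JE : 4 / eps <= s * (J%:R * h).
    rewrite [leRHS]mulrCA -ler_pdivrMr ?(mulr_gt0 s0 h0) //.
    by apply: ltW; exact: truncnS_gt.
  rewrite expRN -[leRHS]invrK lef_pV2 ?posrE ?expR_gt0 ?invr_gt0 ?divr_gt0 //.
  by rewrite invf_div (le_trans JE) // (le_trans _ (expR_ge1Dx _)) // lerDr.
exists J; near=> n.
have bn : 0 <= b n by near: n; exact: b_ge0.
have n0 : (0 < n)%N by near: n; exact: nbhs_infty_gt.
exists (tail h n); split => //.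
- by case=> [|i] // x y; rewrite /tail /norm_gt /= => /lt_le_trans; apply.
- by move=> i x /(tail_coneT bn); rewrite coneT.
(* The limit of [upper] is at most [mass B / s + eps / 2], so [upper] is eventually below the
   target. *)
apply: (le_trans (slice_sum_le J h0 bn n0 mB)); apply: ltW.
near: n; apply: (cvgr_lt _ (upper_cvg (J := J) h0 mB bB)).
rewrite -/s -mulr_sumr -mulrA.
have := ler_wpM2l (mass_ge0 B) (riemann_sum_expR_le J s0 h0).
rewrite mulrDr -/(mass B) -/(mass setT) -/s => sumle.
have := Jlarge; have := Bh; lra.
Unshelve. all: by end_near. Qed.

End tails.
End limit.

(** * Borel-Cantelli for the bad sets *)

Lemma ae_eventually_notin (R : realType) (dd : measure_display)
    (T : measurableType dd) (P : probability T R) (M : nat -> set T) (c : R) :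
  0 <= c -> (forall N, measurable (M N)) ->
  (\forall N \near \oo, (P (M N) <= (c / N%:R ^+ 2)%:E)%E) ->
  {ae P, forall t, \forall N \near \oo, ~ M N t}.
Proof.
(* With [N = k + N1 + 2] the indices without a bound are skipped, and
   [1 / N^2 <= 1 / (k + 1) - 1 / (k + 2)], whose sum telescopes. *)
move=> c0 mM [N1 _ PM]; pose F k := M (k + N1.+2)%N.
have mF k : measurable (F k) by exact: mM.
have PF k : (P (F k) <= (c * (k.+1%:R^-1 - k.+2%:R^-1))%:E)%E.
  have N1k : (N1 <= k + N1.+2)%N by lia.
  apply: (le_trans (PM _ N1k)); rewrite lee_fin ler_wpM2l //.
  have -> : k.+1%:R^-1 - k.+2%:R^-1 = (k.+1%:R * k.+2%:R)^-1 :> R.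
    by rewrite -[k.+2%:R]natr1; field; rewrite nat1r natr1 !pnatr_eq0.
  rewrite lef_pV2 ?posrE ?mulr_gt0 ?exprn_gt0 ?ltr0n ?addnS //.
  by rewrite -natrX -natrM ler_nat; nia.
have sumF : (\sum_(0 <= k <oo) P (F k) < +oo)%E.
  apply: (@le_lt_trans _ _ c%:E); last exact: ltry.
  apply: lime_le; first exact: is_cvg_nneseries.
  near=> n.
  apply: (@le_trans _ _ (\sum_(0 <= k < n) (c * (k.+1%:R^-1 - k.+2%:R^-1))%:E)%E).
    by apply: lee_sum => i _; exact: PF.
  rewrite sumEFin lee_fin -mulr_sumr -[leRHS]mulr1 ler_wpM2l //.
  under eq_bigr do rewrite -opprB.
  rewrite sumrN (telescope_sumr (fun k => k.+1%:R^-1)) // opprB invr1.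
  by rewrite lerBlDr lerDl invr_ge0.
have FP0 := lim_sup_set_cvg0 mF sumF.
exists (lim_sup_set F); split => //.
  apply: bigcapT_measurable => n; exact: bigcup_measurable.
move=> t; apply: contra_notP => /existsNP[k] /not_implyP[_ nF].
exists (k + N1.+2)%N => // N /= kN MN; apply: nF.
exists (N - N1.+2)%N => /=; first by lia.
by rewrite /F subnK //; lia.
Unshelve. all: by end_near. Qed.

(** * Growth of the number and size of the groups *)

Section group_counts.
Context (R : realType) (r : R).
Hypotheses (r0 : 0 < r) (r1 : r < 1).


(** The integer part of [y >= 1] is at least 1, hence at least [y / 2]. *)
Lemma num_groups_bounds N : (0 < N)%N ->
  (N%:R : R) `^ r / 2 <= (num_groups r N)%:R <= (N%:R : R) `^ r.
Proof.
move=> N0; have Nr : 1 <= (N%:R : R) `^ r.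
  have := @ler_powR R N%:R _ 0 r (ltW r0); rewrite powRr0; apply.
  by rewrite ler1n.
have /andP[lo hi] := truncn_itv (le_trans ler01 Nr).
rewrite /num_groups lo andbT.
have : 1 <= (Num.truncn ((N%:R : R) `^ r))%:R :> R by rewrite ler1n truncn_gt0.
by move: hi; rewrite -natr1; lra.
Qed.

Lemma num_groups_gt0 N : (0 < N)%N -> (0 < num_groups r N)%N.
Proof.
move=> N0; have /andP[lo _] := num_groups_bounds N0.
by rewrite -(ltr0n R) (lt_le_trans _ lo) // divr_gt0 // powR_gt0 // ltr0n.
Qed.

(** From [n <= N^r], the inequality [K n <= N] follows as soon as [K <= N^(1 - r)]. *)
Lemma group_size_cvg K : \forall N \near \oo, (K <= group_size r N)%N.
Proof.
near=> N.
have N0 : (0 < N)%N by near: N; exact: nbhs_infty_gt.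
rewrite /group_size leq_divRL ?num_groups_gt0 // -(ler_nat R) natrM.
have /andP[_ hi] := num_groups_bounds N0.
apply: (le_trans (ler_wpM2l _ hi)) => //.
have s0 : 0 < 1 - r by rewrite subr_gt0.
have KN : K%:R <= (N%:R : R) `^ (1 - r).
  have -> : K%:R = (K%:R `^ (1 - r)^-1) `^ (1 - r) :> R.
    by rewrite -powRrM mulVf ?gt_eqF // powRr1.
  apply: ge0_ler_powR; rewrite ?nnegrE ?powR_ge0 ?(ltW s0) //.
  by near: N; exact: nbhs_infty_ger.
apply: (le_trans (ler_wpM2r _ KN)); first exact: powR_ge0.
rewrite -powRD ?subrK ?powRr1 //.
by apply/implyP => _; rewrite pnatr_eq0; lia.
Unshelve. all: by end_near. Qed.

(** Since [n >= N^r / 2] and [e^y >= y^p / p!], an integer [p] with [r p >= 2] gives the summable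
    order [N^(-2)]. *)
Lemma expR_num_groups_le (kap : R) : 0 < kap -> exists2 c : R, 0 <= c &
  forall N, (0 < N)%N -> expR (- ((num_groups r N)%:R * kap)) <= c / N%:R ^+ 2.
Proof.
move=> kap0; pose p := (Num.truncn (2 / r)).+1.
have rp : 2 <= r * p%:R.
  by rewrite mulrC -ler_pdivrMr //; apply: ltW; exact: truncnS_gt.
exists (p`!%:R / (kap / 2) ^+ p).
  by rewrite divr_ge0 // exprn_ge0 // divr_ge0 // ltW.
move=> N N0; have /andP[lo _] := num_groups_bounds N0.
have N1 : 1 <= N%:R :> R by rewrite ler1n.
pose y := (N%:R : R) `^ r * (kap / 2).
have y0 : 0 <= y by rewrite mulr_ge0 ?powR_ge0 // divr_ge0 // ltW.
apply: (@le_trans _ _ (expR (- y))).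
  have -> : y = N%:R `^ r / 2 * kap by rewrite /y; ring.
  by rewrite ler_expR lerN2 ler_pM2r.
have ylow : N%:R ^+ 2 * (kap / 2) ^+ p / p`!%:R <= expR y.
  apply: le_trans (expR_ge1Dxn p.-1 y0); rewrite -/p /= ler_wpDl //.
  apply: ler_wpM2r; first by rewrite invr_ge0.
  rewrite /y [in leRHS]exprMn; apply: ler_wpM2r.
    by rewrite exprn_ge0 // divr_ge0 // ltW.
  rewrite -(@powR_mulrn _ _ 2) // -(@powR_mulrn _ _ p) ?powR_ge0 // -powRrM.
  exact: ler_powR.
have low0 : 0 < N%:R ^+ 2 * (kap / 2) ^+ p / p`!%:R :> R.
  by rewrite divr_gt0 ?mulr_gt0 ?exprn_gt0 ?divr_gt0 ?ltr0n ?fact_gt0.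
rewrite expRN (@le_trans _ _ (N%:R ^+ 2 * (kap / 2) ^+ p / p`!%:R)^-1) //.
  by rewrite lef_pV2 ?posrE ?expR_gt0.
by rewrite !invfM invrK le_eqVlt; apply/orP; left; apply/eqP; ring.
Qed.

End group_counts.

(** * Choice of the rate and almost sure upper bound *)

Lemma chernoff_rate (R : realType) (q a : R) : 0 <= q -> q < a ->
  exists2 lam : R, 0 < lam & 0 < lam * a - (expR lam - 1) * q.
Proof.
move=> q0 qa; have a0 : 0 < a by lra.
(* As [e^lam - 1 <= lam / (1 - lam)], the claim reduces to [q < a (1 - lam)], and for this [lam] the
   right side is [(a + q) / 2]. *)
pose lam := (a - q) / (2 * a); have lamE : lam * a = (a - q) / 2.
  by rewrite /lam; field; lra.
have lam0 : 0 < lam by rewrite divr_gt0 //; lra.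
have lam1 : 0 < 1 - lam by rewrite subr_gt0 -(ltr_pM2r a0) lamE mul1r; lra.
exists lam => //; clearbody lam.
have elam : expR lam - 1 <= lam / (1 - lam).
  rewrite lerBlDr; have <- : (1 - lam)^-1 = lam / (1 - lam) + 1 by field; lra.
  rewrite -[expR lam]invrK lef_pV2 ?posrE ?invr_gt0 ?expR_gt0 //.
  by rewrite -expRN expR_ge1Dx.
rewrite subr_gt0 (le_lt_trans (ler_wpM2r q0 elam)) //.
rewrite mulrAC ltr_pdivrMr // -mulrA ltr_pM2l // mulrBr mulr1 mulrC lamE; lra.
Qed.

Section assembly.
Context (R : realType) (d : nat) (alpha : R)
  (sigma : {finite_measure set (borel_sphere R d) -> \bar R})
  (dd : measure_display) (T : measurableType dd) (P : probability T R)
  (xi : nat -> {RV P >-> borel_space R d}) (r : R)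
  (G : forall N : nat, 'I_(num_groups r N) -> {set 'I_N}) (s0 : sphere_type R d).
Hypotheses (halpha : 0 < alpha) (hsigma : sigma setT <> 0%E) (hiid : iid xi)
  (hRV : in_RV (xi 0%N) alpha sigma) (hr0 : 0 < r) (hr1 : r < 1)
  (hG : forall N : nat, (0 < N)%N -> is_grouping (group_size r N) (@G N)).

(** One half of [eps] absorbs the error of the one-group bound; the other half is the gap that makes
    the Chernoff rate positive. *)
Lemma sigma_hat_upper (B : set (borel_sphere R d)) (eps : R) : measurable B ->
  sigma (boundary (B : set (sphere_type R d))) = 0%E -> 0 < eps ->
  {ae P, forall t, \forall N \near \oo,
    sigma_hat s0 (fun k : 'I_N => xi k.+1 t) (@G N) B <
    fine (sigma B) / fine (sigma setT) + eps}.
Proof.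
move=> mB bB eps0; set p := _ / _.
have p0 : 0 <= p by rewrite divr_ge0 // fine_ge0.
have [L [_ hb]] := hRV; have eps2 : 0 < eps / 2 by rewrite divr_gt0.
have [J tailsJ] := tails_bound halpha hsigma hb mB bB eps2.
have [lam lam0 rate0] : exists2 lam : R, 0 < lam &
    0 < lam * (p + eps) - (expR lam - 1) * (p + eps / 2).
  by apply: chernoff_rate; lra.
have [c c0 ratec] := expR_num_groups_le hr0 rate0.
have [m0 _ tails] := tailsJ.
have [N1 _ sizeN] := group_size_cvg hr0 hr1 m0.
(* For [N <= N1] no bound is claimed and the empty set serves, so that [choice] yields a full
   sequence of bad sets. *)
have badM N : exists M : set T, measurable M /\ ((N1 < N)%N ->
    (P M <= (c / N%:R ^+ 2)%:E)%E /\ forall t, ~ M t ->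
    sigma_hat s0 (fun k : 'I_N => xi k.+1 t) (@G N) B < p + eps).
  case: (ltnP N1 N) => N1N; last by exists set0.
  have N0 : (0 < N)%N by lia.
  have [D [D0 Dup Dn0 mD slice_le]] := tails _ (sizeN N (ltnW N1N)).
  have [M [mM PM countM]] := group_chernoff hiid (hG N0) (measurable_cone mB) mD
    (p + eps) lam0 slice_le.
  exists M; split => // _; split.
    by apply: (le_trans PM); rewrite lee_fin; exact: ratec.
  move=> t nMt.
  pose E (i : 'I_(num_groups r N)) : set T :=
    [set t | B (direction s0 (group_max (fun k : 'I_N => xi k.+1 t) (G i)))].
  have n0 : 0 < (num_groups r N)%:R :> R by rewrite ltr0n num_groups_gt0.
  rewrite /sigma_hat mulrC ltr_pdivrMr // mulrC.
  rewrite (eq_bigr (fun i => \1_(E i) t)) => [|i _]; last first.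
    by rewrite !indicE; congr (_%:R); apply/idP/idP; rewrite !inE.
  apply: countM nMt _ => i; exact: direction_group_max_cover.
have [M allM] := choice badM.
have := ae_eventually_notin (P := P) (M := M) c0 (fun N => (allM N).1).
case=> [|Z [mZ PZ subZ]].
  by exists N1.+1 => // N N1N; have [PM _] := (allM N).2 N1N.
exists Z; split => //; apply: subset_trans subZ => t; apply: contra_not => /= nM.
near=> N; have N1N : (N1 < N)%N by near: N; exact: nbhs_infty_gt.
apply: ((allM N).2 N1N).2; by near: N.
Unshelve. all: by end_near. Qed.

End assembly.

(** * Passage to the complement and conclusion *)

Lemma sigma_hatC (R : realType) (d N n : nat) (s0 : sphere_type R d)
    (x : 'I_N -> 'rV[R]_d.+1) (G : 'I_n -> {set 'I_N})
    (B : set (sphere_type R d)) : (0 < n)%N ->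
  sigma_hat s0 x G (~` B) = 1 - sigma_hat s0 x G B.
Proof.
move=> n0; have n0R : n%:R != 0 :> R by rewrite pnatr_eq0 -lt0n.
rewrite /sigma_hat -[X in X - _](mulVf n0R) -mulrBr; congr (_ * _).
rewrite -[n in n%:R - _]card_ord -sumr_const -sumrB.
apply: eq_big => // i _; rewrite !indicE in_setC.
by case: (_ \in B); rewrite ?subrr ?subr0.
Qed.

Unset Implicit Arguments.

(* [xi 0] is the generic vector and [xi 1], [xi 2], ... is the sample. *)
Theorem theorem2p5 (R : realType) (d : nat)
  (alpha : R) (halpha : 0 < alpha)
  (sigma : {finite_measure set (borel_sphere R d) -> \bar R})
  (hsigma : sigma setT <> 0%E)
  (dd : measure_display) (T : measurableType dd) (P : probability T R)
  (xi : nat -> {RV P >-> borel_space R d})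
  (hiid : iid xi)
  (hRV : in_RV (xi 0%N) alpha sigma)
  (r : R) (hr0 : 0 < r) (hr1 : r < 1)
  (G : forall N : nat, 'I_(num_groups r N) -> {set 'I_N})
  (hG : forall N : nat, (0 < N)%N -> is_grouping (group_size r N) (G N))
  (s0 : sphere_type R d)
  (B : set (borel_sphere R d)) (hB : measurable B)
  (hbdB : sigma (boundary (B : set (sphere_type R d))) = 0%E) :
  {ae P, forall t : T,
    sigma_hat s0 (fun k : 'I_N => xi k.+1 t) (G N) B @[N --> \oo]
      --> fine (sigma B) / fine (sigma setT)}.
Proof.
set p := _ / _.
have mBC : measurable (~` B) by exact: measurableC.
have bBC : sigma (boundary (~` B : set (sphere_type R d))) = 0%E.
  by rewrite boundaryC.
have pC : fine (sigma (~` B)) / fine (sigma setT) = 1 - p.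
  have sT0 : fine (sigma setT) != 0.
    by apply/eqP => /eqP; rewrite fine_eq0 ?fin_num_measure // => /eqP.
  have -> : fine (sigma (~` B)) = fine (sigma setT) - fine (sigma B).
    rewrite -(setvU B) measureU //; last by rewrite setICl.
    by rewrite fineD ?fin_num_measure // addrK.
  by rewrite /p mulrBl divff.
(* The tolerances [1 / (j + 1)] are countably many, so one null set serves for all of them. *)
have upB (j : nat) := sigma_hat_upper s0 halpha hsigma hiid hRV hr0 hr1 hG hB hbdB
  (eps := j.+1%:R^-1) ltac:(by rewrite invr_gt0).
have upC (j : nat) := sigma_hat_upper s0 halpha hsigma hiid hRV hr0 hr1 hG mBC bBC
  (eps := j.+1%:R^-1) ltac:(by rewrite invr_gt0).
apply: filterS2 (ae_foralln upB) (ae_foralln upC) => t tB tC.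
apply/cvgrPdist_lt => eps eps0.
pose j := Num.truncn eps^-1.
have jeps : j.+1%:R^-1 < eps.
  by rewrite invf_plt ?posrE //; exact: truncnS_gt.
near=> N.
have N0 : (0 < N)%N by near: N; exact: nbhs_infty_gt.
have lt1 : sigma_hat s0 (fun k : 'I_N => xi k.+1 t) (G N) B < p + j.+1%:R^-1.
  by near: N; exact: tB.
have : sigma_hat s0 (fun k : 'I_N => xi k.+1 t) (G N) (~` B) < 1 - p + j.+1%:R^-1.
  by rewrite -pC; near: N; exact: tC.
(* The upper bound for the complement becomes the lower bound for [B]. *)
rewrite sigma_hatC ?(num_groups_gt0 hr0) // => lt2.
move: (sigma_hat _ _ _ _) j.+1%:R^-1 jeps lt1 lt2 => u e.
by rewrite ltr_norml => *; apply/andP; split; lra.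
Unshelve. all: by end_near. Qed.
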